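(* Let $\mathcal{P}$ be a problem in $F$-$SSR$ and $\mathcal{P}'$ its semi-restricted version. If there is an algorithm that solves exactly (i.e., returns an optimal solution of) every instance $(E,w,m)$ of $\mathcal{P}'$ in which all weights $w(e_i)$ are integers, in time $\mathcal{O}(\mathrm{poly}(n,w(e_m)))$ where $n=|E|$, then $\mathcal{P}$ admits an FPTAS, i.e., there is an algorithm which, given an instance $(E,w)$ of $\mathcal{P}$ and $\varepsilon\in(0,1)$, returns a feasible solution whose objective value is at most $(1+\varepsilon)$ times the optimum, in time polynomial in $n$ and $1/\varepsilon$.
   Context: A problem $\mathcal{P}=(\mathcal{I},k,\mathcal{F})$ in the family $F$-$SSR$ consists of: a set $\mathcal{I}$ of instances, each a pair $(E,w)$ where $E=\{e_1,\ldots,e_n\}$ is a finite set of ground elements and $w:E\to\mathbb{R}^+$ a weight function; a positive integer $k$; and, for every ground set $E$, a collection $\mathcal{F}(k,E)$ of $k$-tuples of nonempty pairwise disjoint subsets of $\{1,\ldots,n\}$ (the feasible solutions; they depend only on $E$, not on $w$), membership in which is decidable in polynomial time. Its goal is to find a feasible solution minimizing $\mathcal{MR}(S_1,\ldots,S_k,A)=\max_{i\ne j}\frac{\sum_{l\in S_i}a_l}{\sum_{l\in S_j}a_l}$, where $a_l=w(e_l)$. Its semi-restricted version $\mathcal{P}'$ has instances $(E,w,m)$ with $(E,w)$ an instance of $\mathcal{P}$ and $m\in\{1,\ldots,|E|\}$; the feasible solutions of $(E,w,m)$ are the tuples $(S_1,\ldots,S_k)\in\mathcal{F}(k,E)$ with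 $\min_{j\in\{1,\ldots,k\}}\max_{i\in S_j}w(e_i)=w(e_m)$; the goal is to minimize the same objective $\mathcal{MR}$ over these feasible solutions.
   Formalization: The set of instances is assumed closed under replacing w by any positive integer weight function on the same E (else the hypothesis on integer weights may be vacuous); algorithms are unit-cost real-arithmetic programs with floor, reporting when no feasible solution exists. *)

(* Defs.v *)
From HB Require Import structures.
From mathcomp Require Import all_boot all_order all_algebra.
From mathcomp Require Import reals.
Set Implicit Arguments.
Unset Strict Implicit.
Unset Printing Implicit Defensive.
Import Order.TTheory GRing.Theory Num.Theory.
Local Open Scope ring_scope.

(* Model of computation: a real RAM in LISP style.  Weights are arbitrary     *)
(* positive reals and running times are measured in the number of elements    *)
(* only, so arithmetic has unit cost.  Data are S-expressions whose atoms are *)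
(* reals; a program denotes a partial function on data.  The cost counts      *)
(* executed instructions, each of which is O(1) when data are represented by  *)
(* pointers to shared cells.  The only numeric constants are naturals.        *)

Inductive data (R : Type) : Type :=
  | DNil
  | DNum of R
  | DCons of data R & data R.

Arguments DNil {R}.

Inductive prog : Type :=
  | PId
  | PNil
  | PConst of nat
  | PHead
  | PTail
  | PIsNum
  | PAdd
  | PSub
  | PMul
  | PDiv
  | PFloor
  | PLeq
  | PPair of prog & prog
  | PSeq of prog & prog             (* first program runs first *)
  | PIf of prog & prog & prog       (* test, then, else *)
  | PWhile of prog & prog.          (* test, body *)

Definition dbool (R : realType) (b : bool) : data R :=
  if b then DNum 1 else DNil.

Definition truthy (R : Type) (v : data R) : bool :=
  if v is DNil then false else true.

Definition is_num (R : Type) (v : data R) : bool :=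
  if v is DNum _ then true else false.

(* [eval p v u t]: on input [v], [p] halts with output [u] after [t] steps.   *)
(* Ill-typed operations and division by zero have no rule: they do not halt   *)
(* with an output.                                                            *)
Inductive eval (R : realType) : prog -> data R -> data R -> nat -> Prop :=
  | EId v : eval PId v v 1
  | ENil v : eval PNil v DNil 1
  | EConst c v : eval (PConst c) v (DNum c%:R) 1
  | EHead v u : eval PHead (DCons v u) v 1
  | ETail v u : eval PTail (DCons v u) u 1
  | EIsNum v : eval PIsNum v (dbool R (is_num v)) 1
  | EAdd x y : eval PAdd (DCons (DNum x) (DNum y)) (DNum (x + y)) 1
  | ESub x y : eval PSub (DCons (DNum x) (DNum y)) (DNum (x - y)) 1
  | EMul x y : eval PMul (DCons (DNum x) (DNum y)) (DNum (x * y)) 1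
  | EDiv x y : y != 0 -> eval PDiv (DCons (DNum x) (DNum y)) (DNum (x / y)) 1
  | EFloor x : eval PFloor (DNum x) (DNum (Num.floor x)%:~R) 1
  | ELeq x y : eval PLeq (DCons (DNum x) (DNum y)) (dbool R (x <= y)) 1
  | EPair p q v u1 u2 t1 t2 :
      eval p v u1 t1 -> eval q v u2 t2 ->
      eval (PPair p q) v (DCons u1 u2) (t1 + t2).+1
  | ESeq p q v u z t1 t2 :
      eval p v u t1 -> eval q u z t2 -> eval (PSeq p q) v z (t1 + t2).+1
  | EIfTrue b p q v u z t1 t2 :
      eval b v u t1 -> truthy u -> eval p v z t2 ->
      eval (PIf b p q) v z (t1 + t2).+1
  | EIfFalse b p q v u z t1 t2 :
      eval b v u t1 -> ~~ truthy u -> eval q v z t2 ->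
      eval (PIf b p q) v z (t1 + t2).+1
  | EWhileStop b p v u t :
      eval b v u t -> ~~ truthy u -> eval (PWhile b p) v v t.+1
  | EWhileStep b p v u v' z t1 t2 t3 :
      eval b v u t1 -> truthy u -> eval p v v' t2 ->
      eval (PWhile b p) v' z t3 ->
      eval (PWhile b p) v z (t1 + t2 + t3).+1.

Lemma eval_functional (R : realType) (p : prog) (v u u' : data R) (t t' : nat) :
  eval p v u t -> eval p v u' t' -> u = u' /\ t = t'.
Proof.
move=> H; elim: H u' t' => {p v u t}; intros;
  match goal with H : eval _ _ ?u' ?t' |- _ = ?u' /\ _ = ?t' =>
    inversion H; subst; clear H end; try by [].
all: repeat match goal with
  | IH : forall u' t', eval ?p ?v u' t' -> _ = u' /\ _ = t',
    H : eval ?p ?v _ _ |- _ => case: (IH _ _ H) => ? ?; clear H; subst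
  end; try by [].
all: by match goal with
  | T : is_true (truthy ?u), N : is_true (~~ truthy ?u) |- _ =>
    rewrite T in N end.
Qed.

Fixpoint dlist (R : Type) (s : seq (data R)) : data R :=
  if s is v :: s' then DCons v (dlist s') else DNil.

(* A polynomial in x and y which, for suitable c and d, dominates any given   *)
(* polynomial on x, y >= 0.                                                   *)
Definition poly2 (R : realType) (c d : nat) (x y : R) : R :=
  c%:R * (1 + x + y) ^+ d.

(* Indices run over 'I_n = {0, ..., n-1} rather than {1, ..., n}; the weight  *)
(* function of E = (e_0, ..., e_(n-1)) is given as l |-> a_l = w(e_l).        *)
Notation weights R n := ({ffun 'I_n -> R}) (only parsing).
Notation solution k n := (k.-tuple {set 'I_n}) (only parsing).

Definition encode_solution (R : realType) (k n : nat) (S : solution k n) :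
    data R :=
  dlist [seq dlist [seq DNum (nat_of_ord i)%:R | i <- enum A]
        | A : {set 'I_n} <- S].

Definition setsum (R : realType) (n : nat) (w : weights R n) (A : {set 'I_n}) :
    R :=
  \sum_(l in A) w l.

(* The ratios are positive, so the default 0 is only reached when k = 1,      *)
(* where there is no pair i != j.                                             *)
Definition MR (R : realType) (k n : nat) (w : weights R n) (S : solution k n) :
    R :=
  \big[Num.max/0]_(ij : 'I_k * 'I_k | ij.1 != ij.2)
     (setsum w (tnth S ij.1) / setsum w (tnth S ij.2)).

Definition setmax (R : realType) (n : nat) (w : weights R n) (A : {set 'I_n}) :
    R :=
  \big[Num.max/0]_(i in A) w i.

(* The default of the minimum is an upper bound of all the [setmax w _], so   *)
(* it plays no role for k > 0.                                                *)
Definition minmax (R : realType) (k n : nat) (w : weights R n)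
    (S : solution k n) : R :=
  \big[Num.min/setmax w setT]_(j < k) setmax w (tnth S j).

(* Ground elements are drawn from a type [elt], and are presented to programs *)
(* through [code].                                                            *)
Record SSR_problem (R : realType) := SSRProblem {
  elt : eqType;
  code : elt -> data R;
  code_inj : injective code;
  inst : forall n : nat, n.-tuple elt -> weights R n -> Prop;
  num : nat;
  feas : forall n : nat, n.-tuple elt -> {set solution num n};
  inst_uniq : forall n (E : n.-tuple elt) (w : weights R n),
    inst E w -> uniq E;
  inst_pos : forall n (E : n.-tuple elt) (w : weights R n),
    inst E w -> forall l, 0 < w l;
  (* A problem does not restrict the weights of a given ground set; only the  *)
  (* integer ones are required here, so that both "all positive reals" and    *)
  (* "all positive integers" are allowed.                                     *)
  inst_int : forall n (E : n.-tuple elt) (w w' : weights R n),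
    inst E w -> (forall l, 0 < w' l) -> (forall l, w' l \is a Num.int) ->
    inst E w';
  num_gt0 : (0 < num)%N;
  feas_nonempty : forall n (E : n.-tuple elt) (S : solution num n),
    uniq E -> S \in feas E -> forall j, tnth S j != set0;
  feas_disjoint : forall n (E : n.-tuple elt) (S : solution num n),
    uniq E -> S \in feas E ->
    forall i j, i != j -> [disjoint tnth S i & tnth S j];
  feas_decidable : exists (D : prog) (c d : nat),
    forall n (E : n.-tuple elt) (S : solution num n), uniq E ->
    exists t : nat,
      eval D (DCons (dlist (map code E)) (encode_solution R S))
           (dbool R (S \in feas E)) t
      /\ (t <= c * (1 + n) ^ d)%N
}.

Definition encode_instance (R : realType) (P : SSR_problem R) (n : nat)
    (E : n.-tuple (elt P)) (w : weights R n) : data R :=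
  dlist [seq DCons (code (tnth E i)) (DNum (w i)) | i <- enum 'I_n].

Definition semi_feas (R : realType) (P : SSR_problem R) (n : nat)
    (E : n.-tuple (elt P)) (w : weights R n) (m : 'I_n) :
    {set solution (num P) n} :=
  [set S in feas E | minmax w S == w m].

Definition optimal (R : realType) (k n : nat) (w : weights R n)
    (F : {set solution k n}) (S : solution k n) : Prop :=
  S \in F /\ forall S' : solution k n, S' \in F -> MR w S <= MR w S'.

Definition approximate (R : realType) (k n : nat) (w : weights R n) (eps : R)
    (F : {set solution k n}) (S : solution k n) : Prop :=
  S \in F /\
  forall S' : solution k n, optimal w F S' -> MR w S <= (1 + eps) * MR w S'.

(* The output [v] is a solution in [F] with property [Q]; when there is no    *)
(* feasible solution at all, the output is [DNil] (which for k > 0 is not the *)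
(* code of a solution).                                                       *)
Definition answers (R : realType) (k n : nat) (F : {set solution k n})
    (Q : solution k n -> Prop) (v : data R) : Prop :=
  if F == set0 then v = DNil
  else exists S : solution k n, Q S /\ v = encode_solution R S.

Definition solves_semi_restricted_int (R : realType) (P : SSR_problem R)
    (A : prog) : Prop :=
  exists c d : nat,
  forall (n : nat) (E : n.-tuple (elt P)) (w : weights R n) (m : 'I_n),
    inst E w -> (forall l, w l \is a Num.int) ->
    exists (v : data R) (t : nat),
      [/\ eval A (DCons (encode_instance E w) (DNum (m : nat)%:R)) v t,
          answers (semi_feas E w m) (optimal w (semi_feas E w m)) v
        & t%:R <= poly2 c d n%:R (w m)].

Definition is_FPTAS (R : realType) (P : SSR_problem R) (B : prog) : Prop :=
  exists c d : nat,
  forall (n : nat) (E : n.-tuple (elt P)) (w : weights R n) (eps : R),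
    inst E w -> 0 < eps < 1 ->
    exists (v : data R) (t : nat),
      [/\ eval B (DCons (encode_instance E w) (DNum eps)) v t,
          answers (feas E) (approximate w eps (feas E)) v
        & t%:R <= poly2 c d n%:R eps^-1].

(* Main.v *)
(* For each m, replace the weights by w'_l = floor (3 n w_l / (eps w_m)) + 1  *)
(* and run the exact algorithm on (E, w', m); since w'_m <= 3 n / eps + 1,    *)
(* this takes time polynomial in n and 1 / eps.  The map w_l |-> w'_l is      *)
(* nondecreasing, so a solution that is feasible for (E, w, m) remains so for *)
(* (E, w', m), and rounding changes the ratios by a factor 1 + eps at most.   *)
(* An optimal solution S* is feasible for some (E, w, m), and the best of the *)
(* n solutions found is at least as good as the one found for that m.         *)
(* Solutions are compared by max_i A_i * max_j (1 / A_j), where A_j are the   *)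
(* sums of the sets: this is MR for k > 1 and 1 for k = 1.                    *)

Require Import Defs.
From HB Require Import structures.
From mathcomp Require Import all_boot all_order all_algebra.
From mathcomp Require Import reals.
From mathcomp Require Import zify ring lra.
Set Implicit Arguments.
Unset Strict Implicit.
Unset Printing Implicit Defensive.
Import Order.TTheory GRing.Theory Num.Theory.
Local Open Scope ring_scope.

(** Call [minmax w S] the threshold of [S]. Each set of a solution with threshold [w m] contains an
    element of weight at least [w m]. After scaling by [3 n / (eps w_m)] all its sums are therefore
    at least [3 n / eps], while rounding changes a sum by at most [n]: a relative error of
    [eps / 3], however large the other weights are. The exact algorithm takes time polynomial in [n]
    and the scaled [w m], which is at most [3 n / eps + 1]; the largest weight does not enter.

    [minmax_scale] keeps solutions feasible under rounding, and [rounding_approx] turns optimality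
    for the rounded weights into a factor [1 + eps] for the original ones. [runs_body] carries the
    invariant [best_so_far] through the loop over [m]. Every feasible solution has the weight of
    some element as its threshold, so in [runs_fptas] the final best has been compared with all of
    them; [ratio_key_MR] passes from the computed key to [MR]. The remaining work is cost
    accounting, closed by [fptas_time_bound] and [poly2_le]. *)

(** * Execution with an upper bound on the cost *)

(** Unlike the exact cost in [eval], a bound can be shared by the branches of a test and weakened to
    a closed form. *)
Definition runs (R : realType) (p : prog) (v u : data R) (T : nat) : Prop :=
  exists t, eval p v u t /\ (t <= T)%N.

(** Lets [execute] synthesize the output and the bound, leaving an equation and an inequality to
    prove. *)
Lemma runs_conv (R : realType) p (v u u' : data R) T T' :
  runs p v u T -> u = u' -> (T <= T')%N -> runs p v u' T'.
Proof.
by move=> [t [ev tT]] <- TT'; exists t; split=> //; apply: leq_trans TT'.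
Qed.

Lemma runs_le (R : realType) p (v u : data R) T T' :
  runs p v u T -> (T <= T')%N -> runs p v u T'.
Proof. by move=> pT; apply: runs_conv pT _. Qed.

Lemma runs_instr (R : realType) p (v u : data R) : eval p v u 1 -> runs p v u 1.
Proof. by exists 1%N. Qed.

Lemma runs_pair (R : realType) p q (v u1 u2 : data R) T1 T2 :
  runs p v u1 T1 -> runs q v u2 T2 ->
  runs (PPair p q) v (DCons u1 u2) (T1 + T2).+1.
Proof.
move=> [t1 [ev1 le1]] [t2 [ev2 le2]]; exists (t1 + t2).+1.
by split; [apply: EPair|rewrite ltnS leq_add].
Qed.

Lemma runs_seq (R : realType) p q (v u z : data R) T1 T2 :
  runs p v u T1 -> runs q u z T2 -> runs (PSeq p q) v z (T1 + T2).+1.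
Proof.
move=> [t1 [ev1 le1]] [t2 [ev2 le2]]; exists (t1 + t2).+1.
by split; [apply: ESeq ev1 ev2|rewrite ltnS leq_add].
Qed.

Lemma runs_if (R : realType) b p q (v u z : data R) T1 T2 :
  runs b v u T1 -> (truthy u -> runs p v z T2) ->
  (~~ truthy u -> runs q v z T2) -> runs (PIf b p q) v z (T1 + T2).+1.
Proof.
move=> [t1 [ev1 le1]] Hp Hq; have [Tu|Fu] := boolP (truthy u).
  have [t2 [ev2 le2]] := Hp Tu; exists (t1 + t2).+1.
  by split; [apply: EIfTrue ev1 Tu ev2|rewrite ltnS leq_add].
have [t2 [ev2 le2]] := Hq Fu; exists (t1 + t2).+1.
by split; [apply: EIfFalse ev1 Fu ev2|rewrite ltnS leq_add].
Qed.

Lemma runs_while_stop (R : realType) b p (v u : data R) T :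
  runs b v u T -> ~~ truthy u -> runs (PWhile b p) v v T.+1.
Proof.
by move=> [t [ev le]] Fu; exists t.+1; split=> //; apply: EWhileStop ev Fu.
Qed.

Lemma runs_while_step (R : realType) b p (v u v' z : data R) T1 T2 T3 :
  runs b v u T1 -> truthy u -> runs p v v' T2 ->
  runs (PWhile b p) v' z T3 -> runs (PWhile b p) v z (T1 + T2 + T3).+1.
Proof.
move=> [t1 [ev1 le1]] Tu [t2 [ev2 le2]] [t3 [ev3 le3]].
exists (t1 + t2 + t3).+1.
by split; [apply: EWhileStep ev1 Tu ev2 ev3|rewrite ltnS !leq_add].
Qed.

(* Symbolic execution of straight-line code; calls to named programs are      *)
(* discharged by hypotheses.                                                  *)
Ltac run :=
  first [ eassumption
        | lazymatch goal with
          | |- runs (PSeq _ _) _ _ _ => eapply runs_seq; [run | run]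
          | |- runs (PPair _ _) _ _ _ => eapply runs_pair; [run | run]
          | |- runs _ _ _ _ => apply: runs_instr; once constructor
          end
        | idtac ].

Ltac execute := eapply runs_conv; [run | | ].

(** * Folds, maps and lookup on encoded lists *)

(* [body] maps [element . (accumulator . environment)] to the next            *)
(* accumulator.                                                               *)
Definition PFold (body : prog) : prog :=
  PSeq (PWhile PHead
         (PPair (PSeq PHead PTail)
           (PPair (PSeq (PPair (PSeq PHead PHead) PTail) body)
                  (PSeq PTail PTail))))
       (PSeq PTail PHead).

(** The invariant is a relation because the loop of [PFptas] depends on the outputs of the given
    algorithm, of which only a specification is known. *)
Lemma runs_fold (R : realType) body (env : data R) (s : seq (data R))
    (I : nat -> data R -> Prop) T a :
  I 0%N a ->
  (forall j b, (j < size s)%N -> I j b -> exists b',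
     runs body (DCons (nth DNil s j) (DCons b env)) b' T /\ I j.+1 b') ->
  exists b, runs (PFold body) (DCons (dlist s) (DCons a env)) b
                 (size s * (T + 20) + 20) /\ I (size s) b.
Proof.
move=> Ia Istep; suff [b [loop Ib]]: exists b, runs
    (PWhile PHead
       (PPair (PSeq PHead PTail)
         (PPair (PSeq (PPair (PSeq PHead PHead) PTail) body)
                (PSeq PTail PTail))))
    (DCons (dlist s) (DCons a env)) (DCons DNil (DCons b env))
    (size s * (T + 20) + 2) /\ I (size s) b.
  by exists b; split=> //; rewrite /PFold; execute => //; lia.
(* [I] is generalized because the tail of the list is processed under the invariant shifted by
   one. *)
elim: s I a Ia Istep => [|x s IHs] I a Ia Istep.
  exists a; split=> //.
  by eapply runs_le; [eapply runs_while_stop; [run|]|].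
have [b [bodyb Ib]] := Istep 0%N a isT Ia.
have {}Istep j c : (j < size s)%N -> I j.+1 c -> exists b',
    runs body (DCons (nth DNil s j) (DCons c env)) b' T /\ I j.+2 b'.
  exact: (Istep j.+1).
have [z [loop Iz]] := IHs (fun j => I j.+1) b Ib Istep.
exists z; split=> //=; rewrite /= in bodyb.
eapply runs_le; first eapply runs_while_step; [run|by []|run|exact: loop|].
lia.
Qed.

Lemma runs_foldl (R : realType) body (env : data R) (X : eqType) (A : Type)
    (ex : X -> data R) (ea : A -> data R) (f : A -> X -> A) (s : seq X) T a :
  (forall b x, x \in s ->
     runs body (DCons (ex x) (DCons (ea b) env)) (ea (f b x)) T) ->
  runs (PFold body) (DCons (dlist (map ex s)) (DCons (ea a) env))
       (ea (foldl f a s)) (size s * (T + 20) + 20).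
Proof.
move=> step.
have [||b [fold]] := @runs_fold R body env (map ex s)
  (fun j b => b = ea (foldl f a (take j s))) T (ea a).
- by rewrite take0.
- move=> j b; rewrite size_map => js ->.
  (* A nonempty [s] supplies the default element for [nth]. *)
  case: s step js => // x0 s' step js; set s := x0 :: s' in step js *.
  exists (ea (foldl f a (take j.+1 s))); split=> //.
  rewrite (nth_map x0) // (take_nth x0) // foldl_rcons.
  by apply: step; rewrite mem_nth.
by move=> Eb; move: fold; rewrite Eb size_map take_size.
Qed.

Definition PRevMap (f : prog) : prog :=
  PSeq (PPair PHead (PPair PNil PTail))
    (PFold (PPair (PSeq (PPair PHead (PSeq PTail PTail)) f)
                  (PSeq PTail PHead))).

(** The second pass undoes the reversal: on [element . environment], [PHead] returns the element
    unchanged. *)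
Definition PMap (f : prog) : prog :=
  PSeq (PPair (PRevMap f) PNil) (PRevMap PHead).

Lemma runs_revmap (R : realType) f (env : data R) (X : eqType)
    (ex fx : X -> data R) (s : seq X) T :
  (forall x, x \in s -> runs f (DCons (ex x) env) (fx x) T) ->
  runs (PRevMap f) (DCons (dlist (map ex s)) env) (dlist (rev (map fx s)))
       (size s * (T + 40) + 40).
Proof.
move=> fP; rewrite -[rev _]cats0.
have -> : rev (map fx s) ++ [::] = foldl (fun b x => fx x :: b) [::] s.
  by rewrite -catrevE; elim: s {fP} [::] => //= x s IHs b; rewrite IHs.
rewrite /PRevMap; set f' := (X in PFold X).
have fold : runs (PFold f') (DCons (dlist (map ex s)) (DCons DNil env))
    (dlist (foldl (fun b x => fx x :: b) [::] s))
    (size s * ((T + 20) + 20) + 20).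
  apply: (@runs_foldl R f' env X _ ex (@dlist R) _ s _ [::]) => b x xs.
  by have call := fP x xs; rewrite /f'; execute => //; lia.
by execute => //; lia.
Qed.

Lemma runs_map (R : realType) f (env : data R) (X : eqType)
    (ex fx : X -> data R) (s : seq X) T :
  (forall x, x \in s -> runs f (DCons (ex x) env) (fx x) T) ->
  runs (PMap f) (DCons (dlist (map ex s)) env) (dlist (map fx s))
       (size s * (T + 90) + 90).
Proof.
move=> fP; have call1 := runs_revmap fP.
have call2 : runs (PRevMap PHead) (DCons (dlist (rev (map fx s))) DNil)
    (dlist (map fx s)) (size s * (1 + 40) + 40).
  rewrite -map_rev -{2}(revK s) [in X in runs _ _ X]map_rev -(size_rev s).
  by apply: runs_revmap => x _; run.
by rewrite /PMap; execute => //; lia.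
Qed.

(* [index . list] to the second component of the list element at that index. *)
Definition PLookup : prog :=
  PSeq (PWhile (PSeq (PPair (PConst 1) PHead) PLeq)
         (PPair (PSeq (PPair PHead (PConst 1)) PSub) (PSeq PTail PTail)))
       (PSeq PTail (PSeq PHead PTail)).

Lemma runs_lookup (R : realType) (s : seq (data R)) (i : nat) (a b : data R) :
  (i < size s)%N -> nth DNil s i = DCons a b ->
  runs PLookup (DCons (DNum i%:R) (dlist s)) b (i * 30 + 30).
Proof.
move=> ltis nthi; suff loop: runs
    (PWhile (PSeq (PPair (PConst 1) PHead) PLeq)
       (PPair (PSeq (PPair PHead (PConst 1)) PSub) (PSeq PTail PTail)))
    (DCons (DNum i%:R) (dlist s))
    (DCons (DNum 0) (DCons (DCons a b) (dlist (drop i.+1 s)))) (i * 30 + 20).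
  by rewrite /PLookup; execute => //; lia.
elim: i s ltis nthi => [|i IHi] [|x s] //= ltis nthi.
  rewrite nthi drop0; eapply runs_le.
    by eapply runs_while_stop; [run|rewrite ler10].
  by lia.
have loop := IHi s ltis nthi; eapply runs_le.
  eapply runs_while_step; [run| |run|].
  - by rewrite ler1n.
  - by rewrite -natr1 addrK; exact: loop.
lia.
Qed.

(** * Computing the key of a solution *)

Definition PSetSum : prog :=
  PSeq (PPair PHead (PPair (PConst 0) PTail))
    (PFold (PSeq (PPair (PSeq PTail PHead)
                        (PSeq (PPair PHead (PSeq PTail PTail)) PLookup)) PAdd)).

Lemma foldl_addr (V : nmodType) (X : Type) (f : X -> V) (s : seq X) (a : V) :
  foldl (fun b x => b + f x) a s = a + \sum_(x <- s) f x.
Proof.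
elim: s a => [|x s IHs] a /=; first by rewrite big_nil addr0.
by rewrite IHs big_cons addrA.
Qed.

Lemma nth_encode_instance (R : realType) (P : SSR_problem R) (n : nat)
    (E : n.-tuple (elt P)) (w : {ffun 'I_n -> R}) (i : 'I_n) :
  nth DNil [seq DCons (code (tnth E i)) (DNum (w i)) | i <- enum 'I_n] i =
  DCons (code (tnth E i)) (DNum (w i)).
Proof. by rewrite (nth_map i) ?size_enum_ord // nth_ord_enum. Qed.

Lemma runs_setsum (R : realType) (P : SSR_problem R) (n : nat)
    (E : n.-tuple (elt P)) (w : {ffun 'I_n -> R}) (A : {set 'I_n}) :
  runs PSetSum
    (DCons (dlist [seq DNum (nat_of_ord i)%:R | i <- enum A])
           (encode_instance E w))
    (DNum (setsum w A)) (n * (n * 30 + 70) + 40).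
Proof.
rewrite /PSetSum; set body := (X in PFold X).
have fold : runs (PFold body)
    (DCons (dlist [seq DNum (nat_of_ord i)%:R | i <- enum A])
           (DCons (DNum 0%:R) (encode_instance E w)))
    (DNum (foldl (fun b i => b + w i) 0%:R (enum A)))
    (size (enum A) * ((n * 30 + 50) + 20) + 20).
  apply: (@runs_foldl R body (encode_instance E w) _ _
    (fun i : 'I_n => DNum (nat_of_ord i)%:R) (@DNum R)) => b i _.
  have call := @runs_lookup R _ i _ _ _ (nth_encode_instance E w i).
  rewrite size_map size_enum_ord in call; have {}call := call (ltn_ord i).
  rewrite -/(encode_instance E w) in call.
  by rewrite /body; execute => //; have := ltn_ord i; lia.
execute; first by rewrite foldl_addr add0r /setsum big_enum.
have : (size (enum A) <= n)%N.
  by rewrite -cardE -[X in (_ <= X)%N]card_ord max_card.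
nia.
Qed.

Definition PMax : prog :=
  PSeq (PPair PId (PPair (PConst 0) PNil))
    (PFold (PIf (PSeq (PPair (PSeq PTail PHead) PHead) PLeq)
                PHead (PSeq PTail PHead))).

(** The start value 0 is harmless here: the entries will be positive sums and their inverses. *)
Definition maxseq (R : realType) (s : seq R) : R := foldl Num.max 0 s.

Lemma runs_max (R : realType) (s : seq R) :
  runs PMax (dlist (map (@DNum R) s)) (DNum (maxseq s)) (size s * 40 + 30).
Proof.
rewrite /PMax; set body := (X in PFold X).
have fold : runs (PFold body)
    (DCons (dlist (map (@DNum R) s)) (DCons (DNum 0%:R) DNil))
    (DNum (maxseq s)) (size s * (20 + 20) + 20).
  apply: (@runs_foldl R body DNil _ _ (@DNum R) (@DNum R)) => b x _.
  apply: runs_le (_ : (16 <= 20)%N) => //.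
  apply: (@runs_if _ _ _ _ _ (dbool R (b <= x)) _ 7 8).
  - by execute.
  - by case: leP => // _ _; execute.
  - by case: leP => // _ _; execute.
by execute => //; lia.
Qed.

Lemma foldl_max_ge (R : realType) (s : seq R) (a x : R) :
  x \in a :: s -> x <= foldl Num.max a s.
Proof.
elim: s a x => [|y s IHs] a x /=; first by rewrite inE => /eqP ->.
rewrite !inE => /or3P[/eqP->|/eqP->|xs].
- by apply: le_trans (IHs _ _ (mem_head _ _)); rewrite le_max lexx.
- by apply: le_trans (IHs _ _ (mem_head _ _)); rewrite le_max lexx orbT.
- by apply: IHs; rewrite inE xs orbT.
Qed.

Lemma maxseq_ge (R : realType) (s : seq R) x : x \in s -> x <= maxseq s.
Proof. by move=> xs; apply: foldl_max_ge; rewrite inE xs orbT. Qed.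

Lemma maxseq_mem (R : realType) (s : seq R) : maxseq s \in 0 :: s.
Proof.
rewrite /maxseq; elim: s 0 => [|y s IHs] a /=; first exact: mem_head.
have := IHs (Num.max a y); rewrite !inE.
case/orP=> [/eqP->|->]; last by rewrite !orbT.
by case: leP => _; rewrite eqxx ?orbT.
Qed.

(** On a nonempty list of positive numbers this is the largest ratio [x / y] over all pairs of
    entries, the diagonal included, obtained from two linear passes. *)
Definition ratio_key (R : realType) (s : seq R) : R :=
  maxseq s * maxseq [seq 1 / x | x <- s].

Definition PKey : prog :=
  PSeq (PMap PSetSum)
    (PSeq (PPair PMax
                 (PSeq (PPair PId PNil)
                   (PSeq (PMap (PSeq (PPair (PConst 1) PHead) PDiv)) PMax)))
          PMul).

Definition setsums (R : realType) (k n : nat) (w : {ffun 'I_n -> R})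
    (S : k.-tuple {set 'I_n}) : seq R :=
  map (setsum w) S.

Lemma runs_key (R : realType) (P : SSR_problem R) (k n : nat)
    (E : n.-tuple (elt P)) (w : {ffun 'I_n -> R}) (S : k.-tuple {set 'I_n}) :
  (forall A, A \in S -> setsum w A != 0) ->
  runs PKey (DCons (encode_solution R S) (encode_instance E w))
    (DNum (ratio_key (setsums w S)))
    (k * (n * (n * 30 + 70) + 400) + 400).
Proof.
move=> S0; have call1 := @runs_map R PSetSum (encode_instance E w) _
  (fun A : {set 'I_n} => dlist [seq DNum (nat_of_ord i)%:R | i <- enum A])
  (fun A => DNum (setsum w A)) S _ (fun A _ => runs_setsum E w A).
rewrite -/(encode_solution R S) size_tuple in call1.
have Ess : [seq DNum (setsum w A) | A : {set 'I_n} <- S] =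
           map (@DNum R) (setsums w S).
  by rewrite /setsums -map_comp.
rewrite Ess in call1.
have size_ss : size (setsums w S) = k by rewrite size_map size_tuple.
have call2 := runs_max (setsums w S).
have call3 : runs (PMap (PSeq (PPair (PConst 1) PHead) PDiv))
    (DCons (dlist (map (@DNum R) (setsums w S))) DNil)
    (dlist (map (fun x => DNum (1%:R / x)) (setsums w S)))
    (size (setsums w S) * (6 + 90) + 90).
  apply: runs_map => _ /mapP[A AS ->]; execute => //; exact: S0.
rewrite (map_comp (@DNum R) (fun x => 1 / x)) in call3.
have call4 := runs_max [seq 1 / x | x <- setsums w S].
rewrite /PKey; execute => //; rewrite ?size_map ?size_tuple; lia.
Qed.

Lemma ratio_key_ge (R : realType) (s : seq R) x y :
  (forall z, z \in s -> 0 < z) -> x \in s -> y \in s -> x / y <= ratio_key s.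
Proof.
move=> s0 xs ys; rewrite /ratio_key; apply: ler_pM.
- by rewrite ltW ?s0.
- by rewrite invr_ge0 ltW ?s0.
- exact: maxseq_ge.
- by rewrite -div1r maxseq_ge // (map_f (fun z => 1 / z)).
Qed.

(** The entry [x0] rules out the default 0, so both maxima are attained and their product is a
    single ratio. *)
Lemma ratio_key_le (R : realType) (s : seq R) x0 B :
  (forall z, z \in s -> 0 < z) -> x0 \in s ->
  (forall x y, x \in s -> y \in s -> x / y <= B) -> ratio_key s <= B.
Proof.
move=> s0 x0s le_B; rewrite /ratio_key.
have: maxseq s \in s.
  have := maxseq_mem s; rewrite inE => /orP[/eqP max0|//].
  by have := maxseq_ge x0s; rewrite max0 leNgt s0.
have: maxseq [seq 1 / x | x <- s] \in [seq 1 / x | x <- s].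
  have := maxseq_mem [seq 1 / x | x <- s]; rewrite inE => /orP[/eqP max0|//].
  have := maxseq_ge (map_f (fun z => 1 / z) x0s).
  by rewrite max0 leNgt div1r invr_gt0 s0.
by case/mapP=> y ys -> xs; rewrite div1r le_B.
Qed.

(** * Sums, ratios and thresholds *)

Lemma setsum_ge (R : realType) (n : nat) (w : {ffun 'I_n -> R})
    (A : {set 'I_n}) i :
  (forall l, 0 < w l) -> i \in A -> w i <= setsum w A.
Proof.
move=> w0 iA; rewrite /setsum (bigD1 i) //= lerDl.
by apply: sumr_ge0 => l _; rewrite ltW.
Qed.

Lemma setsum_gt0 (R : realType) (n : nat) (w : {ffun 'I_n -> R})
    (A : {set 'I_n}) :
  (forall l, 0 < w l) -> A != set0 -> 0 < setsum w A.
Proof.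
by move=> w0 /set0Pn[i iA]; apply: lt_le_trans (w0 i) (setsum_ge w0 iA).
Qed.

Lemma MR_ge (R : realType) (k n : nat) (w : {ffun 'I_n -> R})
    (S : k.-tuple {set 'I_n}) (i j : 'I_k) :
  i != j -> setsum w (tnth S i) / setsum w (tnth S j) <= MR w S.
Proof.
move=> ij; rewrite /MR.
exact: (@le_bigmax_cond _ _ _ _ (i, j) (fun ij => ij.1 != ij.2)
  (fun ij => setsum w (tnth S ij.1) / setsum w (tnth S ij.2))).
Qed.

Lemma MR_le (R : realType) (k n : nat) (w : {ffun 'I_n -> R})
    (S : k.-tuple {set 'I_n}) (B : R) :
  0 <= B ->
  (forall i j : 'I_k, i != j ->
     setsum w (tnth S i) / setsum w (tnth S j) <= B) ->
  MR w S <= B.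
Proof. by move=> B0 le_B; apply: bigmax_le => // -[i j]; apply: le_B. Qed.

Lemma setmax_attained (R : realType) (n : nat) (w : {ffun 'I_n -> R})
    (A : {set 'I_n}) :
  (forall l, 0 < w l) -> A != set0 ->
  exists i, [/\ i \in A, setmax w A = w i & forall l, l \in A -> w l <= w i].
Proof.
move=> w0 /set0Pn[i0 i0A].
case: (@Order.TotalTheory.arg_maxP _ _ _ i0 (mem A) w i0A) => i iA imax.
exists i; split=> //; apply/le_anti/andP; split.
  by apply: bigmax_le => [|l /imax]; first rewrite ltW.
exact: le_bigmax_cond.
Qed.

Lemma minmax_attained (R : realType) (k n : nat) (w : {ffun 'I_n -> R})
    (S : k.-tuple {set 'I_n}) :
  (0 < k)%N -> exists j, minmax w S = setmax w (tnth S j)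
    /\ forall j', setmax w (tnth S j) <= setmax w (tnth S j').
Proof.
move=> k0; pose j0 := Ordinal k0.
case: (@Order.TotalTheory.arg_minP _ _ _ j0 predT
  (fun j => setmax w (tnth S j)) isT) => j _ jmin.
exists j; split=> [|j']; last exact: jmin.
apply/le_anti/andP; split; first exact: (bigmin_le _ j).
apply: le_bigmin => [|j' _]; last exact: jmin.
apply: bigmax_le => [|l _]; first exact: bigmax_ge_id.
by apply: le_bigmax_cond; rewrite inE.
Qed.

(** The right-hand side mentions only comparisons with [w m], so it survives any nondecreasing
    change of the weights. *)
Lemma minmaxP (R : realType) (k n : nat) (w : {ffun 'I_n -> R})
    (S : k.-tuple {set 'I_n}) (m : 'I_n) :
  (0 < k)%N -> (forall l, 0 < w l) -> (forall j, tnth S j != set0) ->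
  minmax w S = w m <->
  (forall j, exists2 i, i \in tnth S j & w m <= w i) /\
  (exists j, forall i, i \in tnth S j -> w i <= w m).
Proof.
move=> k0 w0 S0; have [j [-> jmin]] := minmax_attained w S k0; split.
  move=> Em; split=> [j'|].
    have [i [iS Ei _]] := setmax_attained w0 (S0 j').
    by exists i; rewrite // -Em -Ei jmin.
  by exists j => i iS; rewrite -Em; apply: le_bigmax_cond.
case=> [ge_m [j' le_m]]; apply/le_anti/andP; split.
  apply: le_trans (jmin j') _.
  by apply: bigmax_le => [|l]; [apply: ltW|apply: le_m].
have [i iS m_i] := ge_m j; apply: le_trans m_i _; exact: le_bigmax_cond.
Qed.

(** * Rounding the weights *)

(** Adding 1 keeps the rounded weights positive, as [inst_int] requires, and makes the rounding
    error one-sided. *)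
Definition scale (R : realType) (n : nat) (r : R) (w : {ffun 'I_n -> R}) :
    {ffun 'I_n -> R} :=
  [ffun l => (Num.floor (w l * r))%:~R + 1].

Lemma scale_itv (R : realType) (n : nat) (r : R) (w : {ffun 'I_n -> R}) l :
  w l * r <= scale r w l <= w l * r + 1.
Proof.
rewrite ffunE lerD2r; have /andP[-> ] := floor_itv (w l * r).
by rewrite intrD andbT => /ltW.
Qed.

Lemma scale_gt0 (R : realType) (n : nat) (r : R) (w : {ffun 'I_n -> R}) :
  0 < r -> (forall l, 0 < w l) -> forall l, 0 < scale r w l.
Proof.
move=> r0 w0 l; have /andP[+ _] := scale_itv r w l; apply: lt_le_trans.
exact: mulr_gt0.
Qed.

Lemma scale_int (R : realType) (n : nat) (r : R) (w : {ffun 'I_n -> R}) l :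
  scale r w l \is a Num.int.
Proof. by rewrite ffunE rpredD ?rpred1 ?intr_int. Qed.

Lemma scale_mono (R : realType) (n : nat) (r : R) (w : {ffun 'I_n -> R}) i l :
  0 <= r -> w i <= w l -> scale r w i <= scale r w l.
Proof.
move=> r0 wil; rewrite !ffunE lerD2r ler_int.
by apply: le_floor; apply: ler_wpM2r.
Qed.

Lemma setsum_scale (R : realType) (n : nat) (r : R) (w : {ffun 'I_n -> R})
    (A : {set 'I_n}) :
  setsum w A * r <= setsum (scale r w) A <= setsum w A * r + n%:R.
Proof.
rewrite /setsum mulr_suml; apply/andP; split.
  by apply: ler_sum => l _; case/andP: (scale_itv r w l).
apply: (@le_trans _ _ (\sum_(l in A) (w l * r + 1))).
  by apply: ler_sum => l _; case/andP: (scale_itv r w l).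
rewrite big_split /= lerD2l sumr_const ler_nat.
by rewrite -[X in (_ <= X)%N]card_ord max_card.
Qed.

Lemma setsums_gt0 (R : realType) (k n : nat) (w : {ffun 'I_n -> R})
    (S : k.-tuple {set 'I_n}) :
  (forall l, 0 < w l) -> (forall j, tnth S j != set0) ->
  forall z, z \in setsums w S -> 0 < z.
Proof.
by move=> w0 S0 _ /mapP[A /tnthP[j ->] ->]; apply: setsum_gt0.
Qed.

Lemma mem_setsums (R : realType) (k n : nat) (w : {ffun 'I_n -> R})
    (S : k.-tuple {set 'I_n}) (j : 'I_k) :
  setsum w (tnth S j) \in setsums w S.
Proof. by rewrite map_f // mem_tnth. Qed.

(** This lower bound is what the rounding error is measured against. *)
Lemma minmax_setsum (R : realType) (k n : nat) (w : {ffun 'I_n -> R})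
    (S : k.-tuple {set 'I_n}) (m : 'I_n) (j : 'I_k) :
  (0 < k)%N -> (forall l, 0 < w l) -> (forall j, tnth S j != set0) ->
  minmax w S = w m -> w m <= setsum w (tnth S j).
Proof.
move=> k0 w0 S0 /minmaxP[] // /(_ j)[i iS wm_i] _.
exact: le_trans wm_i (setsum_ge w0 iS).
Qed.

(** The converse can fail, since rounding may merge distinct weights. Hence [rounding_approx]
    assumes the threshold of [S] for the rounded weights and that of [S'] for the original ones. *)
Lemma minmax_scale (R : realType) (k n : nat) (w : {ffun 'I_n -> R}) (r : R)
    (S : k.-tuple {set 'I_n}) (m : 'I_n) :
  (0 < k)%N -> 0 < r -> (forall l, 0 < w l) -> (forall j, tnth S j != set0) ->
  minmax w S = w m -> minmax (scale r w) S = scale r w m.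
Proof.
move=> k0 r0 w0 S0 /minmaxP[] // ge_m [j le_m].
apply/minmaxP => //; first exact: scale_gt0.
split=> [j'|].
  by have [i iS m_i] := ge_m j'; exists i => //; apply/scale_mono/m_i/ltW.
by exists j => i iS; apply: scale_mono (ltW r0) (le_m i iS).
Qed.

(* Rounding moves each sum by at most [n], which is at most [eps / 3] times   *)
(* any scaled sum, since these are all at least [3 n / eps].  The two losses  *)
(* combine to [(1 + eps / 3) / (1 - eps / 3) <= 1 + eps].                     *)
Lemma rounding_approx (R : realType) (k n : nat) (w : {ffun 'I_n -> R})
    (eps : R) (m : 'I_n) (S S' : k.-tuple {set 'I_n}) :
  let r := 3 * n%:R / eps / w m in
  let w' := scale r w in
  (0 < k)%N -> 0 < eps < 1 -> (forall l, 0 < w l) ->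
  (forall j, tnth S j != set0) -> (forall j, tnth S' j != set0) ->
  minmax w' S = w' m -> minmax w S' = w m -> MR w' S <= MR w' S' ->
  ratio_key (setsums w S) <= (1 + eps) * ratio_key (setsums w S').
Proof.
move=> r w' k0 /andP[eps0 eps1] w0 S0 S'0 minS minS' leMR.
have n0 : 0 < n%:R :> R by rewrite ltr0n (leq_ltn_trans _ (ltn_ord m)).
have r0 : 0 < r by rewrite /r !divr_gt0 ?mulr_gt0.
have w'0 : forall l, 0 < w' l by apply: scale_gt0.
have wmr : w m * r * (eps / 3) = n%:R.
  by rewrite /r; field; rewrite !gt_eqF.
have key1 : 1 <= ratio_key (setsums w S').
  pose j0 := Ordinal k0.
  have := ratio_key_ge (setsums_gt0 w0 S'0) (mem_setsums w S' j0)
    (mem_setsums w S' j0).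
  by rewrite divff // gt_eqF // setsum_gt0.
set K := ratio_key _ in key1 *.
(* For [S'] the loss is in the numerator: [n] is at most [eps / 3] times the scaled original sum.
   Rounding up only helps the denominator. *)
have MRS' : MR w' S' <= (1 + eps / 3) * K.
  apply: MR_le => [|i j _]; first nra.
  have := ratio_key_ge (setsums_gt0 w0 S'0) (mem_setsums w S' i)
    (mem_setsums w S' j); rewrite -/K.
  have Ai := minmax_setsum i k0 w0 S'0 minS'.
  have Aj0 := setsum_gt0 w0 (S'0 j).
  have /andP[_ Wi] := setsum_scale r w (tnth S' i).
  have /andP[Wj _] := setsum_scale r w (tnth S' j).
  have W'j0 := setsum_gt0 w'0 (S'0 j).
  rewrite !ler_pdivrMr // => leK.
  apply: le_trans Wi _.
  apply: (@le_trans _ _ ((1 + eps / 3) * (setsum w (tnth S' i) * r))).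
    rewrite mulrDl mul1r lerD2l -wmr mulrC ler_pM2l ?divr_gt0 //.
    by rewrite ler_pM2r.
  rewrite -[leRHS]mulrA ler_pM2l; last by nra.
  apply: (@le_trans _ _ (K * (setsum w (tnth S' j) * r))).
    by rewrite mulrA ler_pM2r.
  by rewrite ler_pM2l // (lt_le_trans ltr01).
have j0 := Ordinal k0.
apply: (ratio_key_le (setsums_gt0 w0 S0) (mem_setsums w S j0)).
move=> _ _ /mapP[_ /tnthP[i ->] ->] /mapP[_ /tnthP[j ->] ->].
(* The key includes the diagonal, which [MR] omits; there the ratio is 1 and [key1] suffices. *)
have [->|ij] := eqVneq i j.
  by rewrite divff ?gt_eqF ?setsum_gt0 //; nra.
have Aj0 := setsum_gt0 w0 (S0 j).
have /andP[Wi _] := setsum_scale r w (tnth S i).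
have /andP[_ Wj] := setsum_scale r w (tnth S j).
have W'j0 := setsum_gt0 w'0 (S0 j).
have w'm := minmax_setsum j k0 w'0 S0 minS.
have /andP[wm_w'm _] := scale_itv r w m.
have := MR_ge w' S ij; rewrite !ler_pdivrMr // => leMRS.
(* For [S] the loss is in the denominator, and [n] is compared with the rounded sum, because the
   threshold of [S] is known for [w']. *)
have {}Wj : (1 - eps / 3) * setsum w' (tnth S j) <= setsum w (tnth S j) * r.
  rewrite mulrBl mul1r lerBlDr; apply: le_trans Wj _.
  rewrite lerD2l -wmr mulrC ler_pM2l ?divr_gt0 //.
  exact: le_trans wm_w'm w'm.
rewrite -(ler_pM2r r0) -mulrA; apply: le_trans Wi _; apply: le_trans leMRS _.
(* The difference of the two factors of [K] is [eps * (1 - eps) / 3], nonnegative as [eps < 1]. *)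
have le1 : (1 + eps / 3) * K <= (1 + eps) * K * (1 - eps / 3).
  by rewrite mulrAC ler_pM2r ?(lt_le_trans ltr01) //; nra.
apply: (@le_trans _ _ ((1 + eps) * K * (1 - eps / 3) * setsum w' (tnth S j))).
  by rewrite ler_pM2r //; apply: le_trans leMR (le_trans MRS' le1).
by rewrite -mulrA ler_pM2l //; nra.
Qed.

(** Key and [MR] differ only by the diagonal ratio 1. A pair [i != j] tested in [MR w S] also shows
    that [MR w S'] is at least 1; for [k = 1] there is no such pair. *)
Lemma ratio_key_MR (R : realType) (k n : nat) (w : {ffun 'I_n -> R}) (eps : R)
    (S S' : k.-tuple {set 'I_n}) :
  0 <= eps -> (forall l, 0 < w l) ->
  (forall j, tnth S j != set0) -> (forall j, tnth S' j != set0) ->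
  ratio_key (setsums w S) <= (1 + eps) * ratio_key (setsums w S') ->
  MR w S <= (1 + eps) * MR w S'.
Proof.
move=> eps0 w0 S0 S'0 leK.
have MR0 : 0 <= MR w S' by apply: bigmax_ge_id.
have eps1 : 0 < 1 + eps by rewrite (lt_le_trans ltr01) // lerDl.
apply: MR_le => [|i j ij]; first by rewrite mulr_ge0 // ltW.
apply: le_trans (ratio_key_ge (setsums_gt0 w0 S0) (mem_setsums w S i)
  (mem_setsums w S j)) (le_trans leK _).
rewrite ler_pM2l //.
apply: (ratio_key_le (setsums_gt0 w0 S'0) (mem_setsums w S' i)).
move=> _ _ /mapP[_ /tnthP[i1 ->] ->] /mapP[_ /tnthP[j1 ->] ->].
have [->|ij1] := eqVneq i1 j1; last exact: MR_ge.
(* One of the two ratios [A i / A j] and [A j / A i] is at least [1]. *)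
rewrite divff ?gt_eqF ?setsum_gt0 //.
have Ai0 := setsum_gt0 w0 (S'0 i); have Aj0 := setsum_gt0 w0 (S'0 j).
have [leij|/ltW leji] := leP (setsum w (tnth S' i)) (setsum w (tnth S' j)).
  apply: le_trans (MR_ge w S' (_ : j != i)); last by rewrite eq_sym.
  by rewrite ler_pdivlMr ?mul1r.
by apply: le_trans (MR_ge w S' ij); rewrite ler_pdivlMr ?mul1r.
Qed.

(** * The approximation program and its loop invariant *)

Definition PLength : prog :=
  PSeq (PPair PId (PPair (PConst 0) PNil))
    (PFold (PSeq (PPair (PSeq PTail PHead) (PConst 1)) PAdd)).

Lemma runs_length (R : realType) (s : seq (data R)) :
  runs PLength (dlist s) (DNum (size s)%:R) (size s * 40 + 40).
Proof.
rewrite /PLength; set body := (X in PFold X).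
have [||b [fold Eb]] := @runs_fold R body DNil s (fun j b => b = DNum j%:R) 20
  (DNum 0%:R).
- by [].
- move=> j b _ ->; exists (DNum j.+1%:R); split=> //; rewrite /body.
  by execute; rewrite // natr1.
by rewrite Eb in fold; execute => //; lia.
Qed.

Definition PScale : prog :=
  PPair (PSeq PHead PHead)
    (PSeq (PPair (PSeq (PPair (PSeq PHead PTail) PTail) (PSeq PMul PFloor))
                 (PConst 1))
          PAdd).

Lemma runs_scale (R : realType) (P : SSR_problem R) (n : nat)
    (E : n.-tuple (elt P)) (w : {ffun 'I_n -> R}) (r : R) :
  runs (PMap PScale) (DCons (encode_instance E w) (DNum r))
    (encode_instance E (scale r w)) (n * 120 + 90).
Proof.
rewrite -[X in (X * 120)%N](size_enum_ord n).
apply: (@runs_map _ _ _ _ _ _ _ 30) => i _; rewrite /PScale.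
by execute => //; rewrite ffunE.
Qed.

(* Input [(key . solution) . best], where [best] is empty or of the form      *)
(* [key . solution].                                                          *)
Definition PBetter : prog :=
  PIf PTail
      (PIf (PSeq (PPair (PSeq PHead PHead) (PSeq PTail PHead)) PLeq)
           PHead PTail)
      PHead.

Lemma runs_better_nil (R : realType) (v : data R) :
  runs PBetter (DCons v DNil) v 40.
Proof.
eapply runs_le; first eapply (@runs_if _ _ _ _ _ _ _ _ 1); first run.
- by [].
- by move=> _; run.
by [].
Qed.

Lemma runs_better_cons (R : realType) (a b : R) (u v : data R) :
  runs PBetter (DCons (DCons (DNum a) u) (DCons (DNum b) v))
    (if a <= b then DCons (DNum a) u else DCons (DNum b) v) 40.
Proof.
eapply runs_le; first eapply (@runs_if _ _ _ _ _ _ _ _ 20); first run.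
- move=> _; eapply runs_le; first eapply (@runs_if _ _ _ _ _ _ _ _ 1).
  + by run.
  + by case: leP => // _ _; run.
  + by case: leP => // _ _; run.
  by [].
- by [].
by [].
Qed.

(* Input [(code . w_m) . ((m . best) . (instance . 3 n / eps))].              *)
Definition PSolve (A : prog) : prog :=
  PSeq (PPair
         (PSeq (PPair (PSeq PTail (PSeq PTail PHead))
                      (PSeq (PPair (PSeq PTail (PSeq PTail PTail))
                                   (PSeq PHead PTail)) PDiv))
               (PMap PScale))
         (PSeq PTail (PSeq PHead PHead)))
       A.

(* The same input, preceded by the output of [PSolve].                        *)
Definition PUpdate : prog :=
  PIf PHead
      (PSeq (PPair (PPair (PSeq (PPair PHead
                                  (PSeq PTail (PSeq PTail (PSeq PTail PHead))))
                                PKey)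
                          PHead)
                   (PSeq PTail (PSeq PTail (PSeq PHead PTail))))
            PBetter)
      (PSeq PTail (PSeq PTail (PSeq PHead PTail))).

Definition PBody (A : prog) : prog :=
  PSeq (PPair (PSolve A) PId)
       (PPair (PSeq (PPair (PSeq PTail (PSeq PTail (PSeq PHead PHead)))
                           (PConst 1)) PAdd)
              PUpdate).

(** The fold runs over the instance itself, with accumulator [m . best] and environment
    [instance . 3 n / eps]; the counter [m] is the index of the current element. The last test
    strips the key from [best]. *)
Definition PFptas (A : prog) : prog :=
  PSeq (PPair PHead
         (PPair (PPair (PConst 0) PNil)
                (PPair PHead
                       (PSeq (PPair (PSeq (PPair (PConst 3) (PSeq PHead PLength))
                                          PMul)
                                    PTail)
                             PDiv))))
    (PSeq (PFold (PBody A)) (PSeq PTail (PIf PId PTail PNil))).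

(** Lets [PUpdate] tell a solution from the answer [DNil]. *)
Lemma truthy_encode_solution (R : realType) (k n : nat)
    (S : k.-tuple {set 'I_n}) :
  (0 < k)%N -> truthy (encode_solution R S).
Proof. by case: k S => // k S _; case/tupleP: S. Qed.

(** The competitors [S'] are those whose threshold, for the original weights, is one of the first
    [j] weights. The stored [S] is only required to be feasible, since it comes from a rounded
    instance. *)
Definition best_so_far (R : realType) (k n : nat) (w : {ffun 'I_n -> R})
    (eps : R) (F : {set k.-tuple {set 'I_n}}) (j : nat) (v : data R) : Prop :=
  (v = DNil /\
   forall S' (i : 'I_n), S' \in F -> (i < j)%N -> minmax w S' <> w i) \/
  (exists S, [/\
     v = DCons (DNum (ratio_key (setsums w S))) (encode_solution R S),
     S \in F &
     forall S' (i : 'I_n), S' \in F -> (i < j)%N -> minmax w S' = w i ->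
       ratio_key (setsums w S) <= (1 + eps) * ratio_key (setsums w S')]).

Lemma runs_body (R : realType) (P : SSR_problem R) (A : prog) (n : nat)
    (E : n.-tuple (elt P)) (w : {ffun 'I_n -> R}) (eps : R) (m : 'I_n)
    (TA : nat) (best v : data R) :
  let w' := scale (3 * n%:R / eps / w m) w in
  inst E w -> 0 < eps < 1 ->
  runs A (DCons (encode_instance E w') (DNum (m : nat)%:R)) v TA ->
  answers (semi_feas E w' m) (optimal w' (semi_feas E w' m)) v ->
  best_so_far w eps (feas E) m best ->
  exists best',
    runs (PBody A)
      (DCons (DCons (code (tnth E m)) (DNum (w m)))
         (DCons (DCons (DNum (m : nat)%:R) best)
            (DCons (encode_instance E w) (DNum (3 * n%:R / eps)))))
      (DCons (DNum (m.+1)%:R) best')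
      (TA + num P * (n * (n * 30 + 70) + 400) + n * 120 + 1000)
    /\ best_so_far w eps (feas E) m.+1 best'.
Proof.
move=> w' iw eps01 callA ansA bestP.
have w0 := inst_pos iw; have uE := inst_uniq iw; have k0 := num_gt0 P.
have feas0 S := @feas_nonempty R P n E S uE.
have eps0 : 0 < eps by case/andP: eps01.
have n0 : 0 < n%:R :> R by rewrite ltr0n (leq_ltn_trans _ (ltn_ord m)).
have r0 : 0 < 3 * n%:R / eps / w m by rewrite !divr_gt0 ?mulr_gt0.
set input := DCons _ _.
have call : runs (PSolve A) input v (TA + n * 120 + 200).
  have call := runs_scale E w (3 * n%:R / eps / w m).
  by rewrite /PSolve /input; execute => //; [rewrite gt_eqF|lia].
have semiP S' : S' \in feas E -> minmax w S' = w m -> S' \in semi_feas E w' m.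
  move=> fS' minS'; rewrite inE fS' /=; apply/eqP.
  by apply: minmax_scale => //; apply: feas0.
suff [best' [upd best'P]] : exists best', runs PUpdate (DCons v input) best'
    (num P * (n * (n * 30 + 70) + 400) + 600)
    /\ best_so_far w eps (feas E) m.+1 best'.
  exists best'; split=> //; rewrite /PBody; execute.
  - by rewrite natr1.
  - lia.
move: ansA; rewrite /answers; case: eqP => [semi0 Ev|_ [S [[semiS optS] Ev]]].
  exists best; split.
    eapply runs_le; first eapply (@runs_if _ _ _ _ _ _ _ _ 20); first run.
    - by rewrite Ev.
    - by move=> _; rewrite /input; execute.
    lia.
  (* By [semiP], infeasibility of the rounded instance excludes the threshold [w m] for the original
     weights. *)
  have no_m S' : S' \in feas E -> minmax w S' <> w m.
    by move=> fS' minS'; have := semiP S' fS' minS'; rewrite semi0 inE.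
  case: bestP => [[-> none]|[S [-> fS bestS]]]; [left|right].
    split=> // S' i fS'; rewrite ltnS leq_eqVlt => /orP[/eqP/val_inj->|].
      exact: no_m.
    exact: none.
  exists S; split=> // S' i fS'; rewrite ltnS leq_eqVlt.
  by case/orP=> [/eqP/val_inj-> /(no_m _ fS')|]; last apply: bestS.
move: (semiS); rewrite inE => /andP[fS /eqP minS].
have newS S' : S' \in feas E -> minmax w S' = w m ->
    ratio_key (setsums w S) <= (1 + eps) * ratio_key (setsums w S').
  move=> fS' minS'; apply: (rounding_approx k0 eps01 w0 _ _ minS minS').
  - exact: feas0.
  - exact: feas0.
  - exact: optS _ (semiP _ fS' minS').
have callK : runs PKey (DCons (encode_solution R S) (encode_instance E w))
    (DNum (ratio_key (setsums w S)))
    (num P * (n * (n * 30 + 70) + 400) + 400).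
  apply: runs_key => _ /tnthP[j ->]; rewrite gt_eqF // setsum_gt0 //.
  exact: feas0.
set new := DCons (DNum (ratio_key (setsums w S))) (encode_solution R S).
have updP best' : runs PBetter (DCons new best) best' 40 ->
    runs PUpdate (DCons v input) best'
      (num P * (n * (n * 30 + 70) + 400) + 600).
  move=> callB; rewrite Ev; eapply runs_le.
    eapply runs_if; first run.
    - by move=> _; rewrite /input; run.
    - by rewrite truthy_encode_solution.
  lia.
case: bestP => [[Eb none]|[S1 [Eb fS1 bestS1]]].
  exists new; split; first by apply: updP; rewrite Eb; apply: runs_better_nil.
  right; exists S; split=> // S' i fS'; rewrite ltnS leq_eqVlt.
  case/orP=> [/eqP/val_inj->|im]; first exact: newS.
  by move/(none _ _ fS' im).
eexists; split.
  by apply: updP; rewrite Eb; apply: runs_better_cons.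
right; case: leP => [le_new|/ltW le_old].
  exists S; split=> // S' i fS'; rewrite ltnS leq_eqVlt.
  case/orP=> [/eqP/val_inj->|im minS']; first exact: newS.
  exact: le_trans le_new (bestS1 _ _ fS' im minS').
exists S1; split=> // S' i fS'; rewrite ltnS leq_eqVlt.
case/orP=> [/eqP/val_inj-> minS'|]; last exact: bestS1.
exact: le_trans le_old (newS _ fS' minS').
Qed.

(** * Running time and conclusion *)

Lemma fptas_time_bound (k n T : nat) :
  (n * (T + k * (n * (n * 30 + 70) + 400) + n * 120 + 1020) + n * 40 + 200
   <= 2000 * k.+1 * n.+1 ^ 3 * T.+1)%N.
Proof.
have -> : (n.+1 ^ 3 = n * n * n + 3 * (n * n) + 3 * n + 1)%N by ring.
set N := (X in (_ <= _ * X * _)%N).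
have le1 : (n * T <= 2000 * k.+1 * N * T)%N.
  by rewrite leq_mul2r; apply/orP; right; rewrite /N; nia.
have le2 : (n * (k * (n * (n * 30 + 70) + 400) + n * 120 + 1020) + n * 40 + 200
    <= 2000 * k.+1 * N)%N.
  (* After expansion the inequality holds coefficient by coefficient, with monomials such as
     [k * (n * n * n)] as atoms. *)
  have -> : (2000 * k.+1 * N = 2000 * (k * (n * n * n) + 3 * (k * (n * n))
    + 3 * (k * n) + k + N))%N by rewrite -[k.+1]addn1 /N; ring.
  have -> : (n * (k * (n * (n * 30 + 70) + 400) + n * 120 + 1020) + n * 40 + 200
    = 30 * (k * (n * n * n)) + 70 * (k * (n * n)) + 400 * (k * n)
      + 120 * (n * n) + 1060 * n + 200)%N by ring.
  by rewrite /N; lia.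
have -> : (2000 * k.+1 * N * T.+1 = 2000 * k.+1 * N * T + 2000 * k.+1 * N)%N.
  by rewrite mulnS addnC.
by apply: leq_trans (leq_add le1 le2); apply: eq_leq; ring.
Qed.

Lemma runs_fptas (R : realType) (P : SSR_problem R) (A : prog) (n : nat)
    (E : n.-tuple (elt P)) (w : {ffun 'I_n -> R}) (eps : R) (TA : nat) :
  inst E w -> 0 < eps < 1 ->
  (forall m : 'I_n, let w' := scale (3 * n%:R / eps / w m) w in
     exists v, runs A (DCons (encode_instance E w') (DNum (m : nat)%:R)) v TA
       /\ answers (semi_feas E w' m) (optimal w' (semi_feas E w' m)) v) ->
  exists v,
    runs (PFptas A) (DCons (encode_instance E w) (DNum eps)) v
      (2000 * (num P).+1 * n.+1 ^ 3 * TA.+1)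
    /\ answers (feas E) (approximate w eps (feas E)) v.
Proof.
move=> iw eps01 Aok.
have w0 := inst_pos iw; have uE := inst_uniq iw; have k0 := num_gt0 P.
have feas0 S := @feas_nonempty R P n E S uE.
have eps0 : 0 < eps by case/andP: eps01.
set s := [seq DCons (code (tnth E i)) (DNum (w i)) | i <- enum 'I_n].
have size_s : size s = n by rewrite size_map size_enum_ord.
pose env := DCons (encode_instance E w) (DNum (3 * n%:R / eps)).
have [||b [fold [best [Eb bestP]]]] := @runs_fold R (PBody A) env s
  (fun j b => exists best, b = DCons (DNum j%:R) best /\
     best_so_far w eps (feas E) j best)
  (TA + num P * (n * (n * 30 + 70) + 400) + n * 120 + 1000)
  (DCons (DNum 0%:R) DNil).
- by exists DNil; split=> //; left; split.
- move=> j b; rewrite size_s => jn [best [-> bestP]].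
  pose m := Ordinal jn; have [v [callA ansA]] := Aok m.
  have [best' [bodyP best'P]] := runs_body iw eps01 callA ansA bestP.
  exists (DCons (DNum j.+1%:R) best'); split; last by exists best'.
  by rewrite (nth_encode_instance E w m).
rewrite size_s in fold bestP; rewrite {}Eb in fold.
have callL := runs_length s; rewrite size_s in callL.
have [v [fin ansv]] : exists v, runs (PIf PId PTail PNil) best v 10
    /\ answers (feas E) (approximate w eps (feas E)) v.
  (* Every threshold is the weight of some element, so the [n] rounds cover all feasible solutions,
     and an empty [best] means that there are none. *)
  have minE S' : S' \in feas E -> exists i, minmax w S' = w i.
    move=> /feas0 S'0; have [j [-> _]] := minmax_attained w S' k0.
    by have [i [_ -> _]] := setmax_attained w0 (S'0 j); exists i.
  case: bestP => [[-> none]|[S [-> fS bestS]]].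
    exists DNil; split.
      eapply runs_le; first eapply (@runs_if _ _ _ _ _ _ _ _ 1); first run.
      + by [].
      + by move=> _; run.
      by [].
    rewrite /answers ifT //; apply/eqP/setP => S'; rewrite inE.
    apply/negP => fS'; have [i Ei] := minE S' fS'.
    exact: none S' i fS' (ltn_ord i) Ei.
  exists (encode_solution R S); split.
    eapply runs_le; first eapply (@runs_if _ _ _ _ _ _ _ _ 1); first run.
    + by move=> _; run.
    + by [].
    by [].
  rewrite /answers ifF; last by apply/eqP => F0; rewrite F0 inE in fS.
  exists S; split=> //; split=> // S' [fS' _].
  have [i Ei] := minE S' fS'.
  apply: ratio_key_MR => //; [exact: ltW|exact: feas0|exact: feas0|].
  exact: bestS fS' (ltn_ord i) Ei.
exists v; split=> //; rewrite -/(encode_instance E w) in fold callL.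
rewrite /PFptas; execute => //; first by rewrite gt_eqF.
apply: leq_trans (fptas_time_bound _ _ _); lia.
Qed.

(** With [z = 1 + n + y], the base on the left is at most [3 * z ^ 2]. The added 1 accounts for
    [TA.+1] and is absorbed because [1 <= z]. *)
Lemma poly2_le (R : realType) (c d n : nat) (y : R) :
  1 <= y ->
  poly2 c d n%:R (3 * n%:R * y + 1) + 1 <=
  (c * 3 ^ d).+1%:R * (1 + n%:R + y) ^+ (2 * d).
Proof.
move=> y1; rewrite /poly2; set z := 1 + n%:R + y.
have n0 : 0 <= n%:R :> R by [].
have z1 : 1 <= z by rewrite /z; nra.
rewrite -(natr1 (c * 3 ^ d)) [leRHS]mulrDl mul1r; apply: lerD; last first.
  exact: exprn_ege1.
rewrite natrM natrX -[leRHS]mulrA ler_wpM2l // exprM -exprMn lerXn2r ?nnegrE //.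
- by nra.
- by nra.
by rewrite /z; nra.
Qed.

Theorem theorem2 (R : realType) (P : SSR_problem R) :
  (exists A : prog, solves_semi_restricted_int P A) ->
  exists B : prog, is_FPTAS P B.
Proof.
move=> [A [c [d Aok]]]; exists (PFptas A).
exists (2000 * (num P).+1 * (c * 3 ^ d).+1)%N, (3 + 2 * d)%N.
move=> n E w eps iw eps01; have /andP[eps0 eps1] := eps01.
have w0 := inst_pos iw.
(* [X] bounds the cost of every call of [A], as the rounded weight of [m] is at most [3 n / eps + 1]
   for each [m]; costs are natural numbers, so truncating [X] loses nothing. *)
pose X := poly2 c d n%:R (3 * n%:R * eps^-1 + 1); pose TA := Num.truncn X.
have X0 : 0 <= X.
  by rewrite mulr_ge0 // exprn_ge0 // !addr_ge0 // !mulr_ge0 // invr_ge0 ltW.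
have [m|v [[t [ev le_t]] ansv]] := @runs_fptas R P A n E w eps TA iw eps01.
  set w' := scale _ w => /=.
  have n0 : 0 < n%:R :> R by rewrite ltr0n (leq_ltn_trans _ (ltn_ord m)).
  have w'0 : forall l, 0 < w' l.
    by apply: scale_gt0 => //; rewrite !divr_gt0 ?mulr_gt0.
  have iw' : inst E w' by apply: inst_int iw w'0 _ => l; apply: scale_int.
  have [v [t [ev ansv le_t]]] := Aok n E w' m iw' (scale_int _ _).
  exists v; split=> //; exists t; split=> //.
  rewrite truncn_ge_nat //; apply: le_trans le_t _.
  have /andP[_ le_w'm] := scale_itv (3 * n%:R / eps / w m) w m.
  rewrite [w m * _]mulrC divfK ?gt_eqF // in le_w'm.
  rewrite /X /poly2 ler_wpM2l // lerXn2r ?nnegrE ?lerD2l //.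
    by rewrite !addr_ge0 // ltW.
  by rewrite !addr_ge0 // !mulr_ge0 // invr_ge0 ltW.
exists v, t; split=> //; move: le_t; rewrite -(ler_nat R) => /le_trans; apply.
have y1 : 1 <= eps^-1 by rewrite invf_ge1 // ltW.
have z0 : 0 <= 1 + n%:R + eps^-1 by rewrite !addr_ge0 // (le_trans ler01).
rewrite /poly2; set C := (2000 * _)%N.
rewrite natrM (natrM _ C (n.+1 ^ 3)) natrX (natrM _ C) exprD.
rewrite -[leLHS]mulrA -[leRHS]mulrA ler_wpM2l // [leRHS]mulrCA.
apply: ler_pM; rewrite ?exprn_ge0 //.
  by rewrite lerXn2r ?nnegrE // -natr1 addrC lerDl (le_trans ler01).
apply: le_trans (poly2_le c d n y1).
by rewrite -natr1 lerD2r truncn_le.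
Qed.
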